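(* Let $n\ge1$, let $G$ be a compact group and $H$ a closed subgroup of $G$ such that $G=HZ_n(G)$. Then $d^{(n)}(H)=d^{(n)}(H,G)=d^{(n)}(G)$.
   Context: Commutators are left-normed: $[x,y]=x^{-1}y^{-1}xy$, $[x_1,\dots,x_{m+1}]=[[x_1,\dots,x_m],x_{m+1}]$. $Z_n(G)$ is the $n$-th term of the upper central series. For a compact group $K$, $\mu_K$ is its normalized Haar measure and $\mu_K^m$ the product measure on $K^m$. The $n$-th nilpotency degree of a compact group $K$ is $d^{(n)}(K)=\mu_K^{n+1}(\{(x_1,\dots,x_{n+1})\in K^{n+1}: [x_1,\dots,x_{n+1}]=1\})$. For a closed subgroup $H$ of $G$, the relative $n$-th nilpotency degree is $d^{(n)}(H,G)=(\mu_H^n\times\mu_G)(\{(h_1,\dots,h_n,g)\in H^n\times G:[h_1,\dots,h_n,g]=1\})$. *)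

(* Defs.v *)
From HB Require Import structures.
From mathcomp Require Import all_boot all_order all_algebra.
From mathcomp Require Import all_classical all_reals all_analysis.
Set Implicit Arguments. Unset Strict Implicit. Unset Printing Implicit Defensive.
Import Order.TTheory GRing.Theory Num.Theory.
Import numFieldTopology.Exports numFieldNormedType.Exports.
Local Open Scope classical_set_scope.
Local Open Scope ring_scope.

Definition is_group (G : Type) (mul : G -> G -> G) (inv : G -> G) (one : G) :=
  [/\ forall x y z, mul x (mul y z) = mul (mul x y) z,
      forall x, mul one x = x, forall x, mul x one = x,
      forall x, mul (inv x) x = one & forall x, mul x (inv x) = one].

Definition is_compact_group (G : topologicalType)
    (mul : G -> G -> G) (inv : G -> G) (one : G) :=
  [/\ is_group mul inv one,
      continuous (fun p : G * G => mul p.1 p.2),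
      continuous inv,
      hausdorff_space G & compact [set: G]].

Definition is_closed_subgroup (G : topologicalType)
    (mul : G -> G -> G) (inv : G -> G) (one : G) (H : set G) :=
  [/\ closed H, H one, forall x y, H x -> H y -> H (mul x y)
    & forall x, H x -> H (inv x)].

Definition comm (G : Type) (mul : G -> G -> G) (inv : G -> G) (x y : G) : G :=
  mul (mul (mul (inv x) (inv y)) x) y.

Fixpoint itcomm (G : Type) (mul : G -> G -> G) (inv : G -> G)
    (x : nat -> G) (m : nat) : G :=
  match m with
  | 0 => x 0%N
  | m'.+1 => comm mul inv (itcomm mul inv x m') (x m)
  end.

Fixpoint upper_central (G : Type) (mul : G -> G -> G) (inv : G -> G) (one : G)
    (i : nat) : set G :=
  match i with
  | 0 => [set one]
  | i'.+1 => [set x | forall y, upper_central mul inv one i' (comm mul inv x y)]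
  end.

Definition pow_space (G : topologicalType) (k : nat) := {ptws 'I_k -> G}.

Definition pmul (G : topologicalType) (k : nat) (mul : G -> G -> G)
    (f g : pow_space G k) : pow_space G k := fun i => mul (f i) (g i).

Definition comm_trivial (G : topologicalType) (mul : G -> G -> G) (inv : G -> G)
    (one : G) (n : nat) : set (pow_space G n.+1) :=
  [set x | itcomm mul inv (fun i => x (inord i)) n = one].

Arguments comm_trivial {G} mul inv one n.

Definition borel (X : topologicalType) : set (set X) := <<s [set U | open U] >>.

(** [is_haar mulX S mu]: mu is a regular Borel probability measure on X,
    concentrated on the closed subgroup S (mu S = 1) and invariant under left
    translation by elements of S; i.e. mu is the normalized Haar measure of
    the compact group S (viewed as a measure on X). *)
Definition is_haar (R : realType) (X : topologicalType) (mulX : X -> X -> X)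
    (S : set X) (mu : set X -> R) :=
  mu set0 = 0 /\
  (forall A, borel A -> 0 <= mu A) /\
  (forall F : nat -> set X, (forall i, borel (F i)) -> trivIset setT F ->
     (fun N => \sum_(i < N) mu (F i)) @ \oo --> mu (\bigcup_i F i)) /\
  mu setT = 1 /\ mu S = 1 /\
  (forall s A, S s -> borel A -> mu [set mulX s a | a in A] = mu A) /\
  (forall A (e : R), borel A -> 0 < e ->
     exists K U, [/\ compact K, open U, K `<=` A, A `<=` U
                   & mu U - mu K <= e]).

(* Main.v *)
(** Put X = G^(n+1), let Z be the closed normal subgroup Z_n(G)^(n+1), and let
    S <= S' be two of the three subgroups H^(n+1), H^n x G, G^(n+1) of X, so that
    X = S Z.  Since [gamma_k(G), Z_m(G)] <= Z_(m-k)(G), the closed set A of tuples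
    with trivial commutator is Z-invariant, and it suffices that the Haar measures
    nu of S and mu of S' agree on closed Z-invariant sets, i.e. that Haar measure
    on X / Z is unique.

    For closed Z-invariant A inside an open U, cover X by finitely many sets
    W_b = {x | x^-1 b A <= U}, cut them into disjoint Borel pieces B_b, and
    integrate, against nu(dy),
      sum_b mu(B_b) 1_(bA)(y) <= mu(y U^-1) = mu(U^-1)      (y in S);
    as nu(bA) = nu(A) for every b in X = S Z, this gives nu(A) <= mu(U^-1), hence
    nu(A) <= mu(A^-1) <= mu(A) by regularity.  Applied to the compact sets Z K with
    K compact and disjoint from A, the same inequality bounds the complement of A. *)

Require Import Defs.
From HB Require Import structures.
From mathcomp Require Import all_boot all_order all_algebra.
From mathcomp Require Import all_classical all_reals all_analysis.
From mathcomp Require Import lra.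
Set Implicit Arguments.
Unset Strict Implicit.
Unset Printing Implicit Defensive.
Import Order.TTheory GRing.Theory Num.Theory.
Local Open Scope classical_set_scope.
Local Open Scope ring_scope.

(** * Group words, congruences modulo a normal subgroup, and the upper central series *)

Section GroupTheory.
Variables (G : Type) (mul : G -> G -> G) (inv : G -> G) (one : G).
Hypothesis grpG : is_group mul inv one.

Local Notation "x ** y" := (mul x y) (at level 40, left associativity).
Local Notation Z := (upper_central mul inv one).

Lemma gmulA x y z : x ** (y ** z) = x ** y ** z. Proof. by case: grpG. Qed.
Lemma gmul1 x : one ** x = x. Proof. by case: grpG. Qed.
Lemma gmulr1 x : x ** one = x. Proof. by case: grpG. Qed.
Lemma gmulV x : inv x ** x = one. Proof. by case: grpG. Qed.
Lemma gmulrV x : x ** inv x = one. Proof. by case: grpG. Qed.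
Lemma gmulK x y : inv x ** (x ** y) = y.
Proof. by rewrite gmulA gmulV gmul1. Qed.
Lemma gmulVK x y : x ** (inv x ** y) = y.
Proof. by rewrite gmulA gmulrV gmul1. Qed.
Lemma ginv_uniq x y : x ** y = one -> inv x = y.
Proof. by move=> xy; rewrite -[RHS](gmulK x) xy gmulr1. Qed.
Lemma ginvK x : inv (inv x) = x.
Proof. exact/ginv_uniq/gmulV. Qed.
Lemma ginvM x y : inv (x ** y) = inv y ** inv x.
Proof. by apply: ginv_uniq; rewrite -gmulA gmulVK gmulrV. Qed.
Lemma ginv1 : inv one = one.
Proof. by apply: ginv_uniq; rewrite gmul1. Qed.

(* Rewriting with [gE] computes the reduced, right-associated form of a group word. *)
Let gmulAr x y z : x ** y ** z = x ** (y ** z). Proof. by rewrite gmulA. Qed.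
Definition gE := (gmulAr, ginvM, ginvK, ginv1, gmul1, gmulr1, gmulV, gmulrV,
  gmulK, gmulVK).

Definition normal_subgroup (N : set G) :=
  [/\ N one, forall x y, N x -> N y -> N (x ** y), forall x, N x -> N (inv x)
    & forall x y, N x -> N (inv y ** x ** y)].

Definition cong (N : set G) x y := N (inv x ** y).

Section Cong.
Variable N : set G.
Hypothesis nN : normal_subgroup N.

Lemma cong_sym x y : cong N x y -> cong N y x.
Proof. by case: nN => _ _ NV _ /NV; rewrite /cong !gE. Qed.

Lemma cong_trans y x z : cong N x y -> cong N y z -> cong N x z.
Proof. by case: nN => _ NM _ _ xy yz; have := NM _ _ xy yz; rewrite /cong !gE. Qed.

Lemma cong_mull z x y : cong N x y -> cong N (z ** x) (z ** y).
Proof. by rewrite /cong !gE. Qed.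

Lemma cong_mulr z x y : cong N x y -> cong N (x ** z) (y ** z).
Proof. by case: nN => _ _ _ NJ /(NJ _ z); rewrite /cong !gE. Qed.

Lemma cong_cancell z x y : cong N (z ** x) (z ** y) -> cong N x y.
Proof. by rewrite /cong !gE. Qed.

Lemma cong_div x y : cong N x y -> N (y ** inv x).
Proof. by case: nN => _ _ _ NJ /(NJ _ (inv x)); rewrite !gE. Qed.

End Cong.

(** The word (y z)^-1 (z y) is [z, y], so belonging to Z_(i+1) means being central modulo Z_i. *)
Lemma upper_centralS i z : Z i.+1 z <-> forall y, cong (Z i) (y ** z) (z ** y).
Proof.
by split=> Zz y; have := Zz y; rewrite /cong /comm !gE.
Qed.

Lemma upper_central_normal i : normal_subgroup (Z i).
Proof.
elim: i => [|i nZ].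
  by split=> //= [_ _ -> ->|_ ->|_ y ->]; rewrite !gE.
have [Z1 ZM ZV ZJ] := nZ.
have S1M x y : Z i.+1 x -> Z i.+1 y -> Z i.+1 (x ** y).
  move=> /upper_centralS Zx /upper_centralS Zy; apply/upper_centralS => t.
  apply: (cong_trans nZ (y := x ** t ** y)).
    by rewrite gmulA; exact: cong_mulr.
  by rewrite -!gmulA; exact: cong_mull.
have sub x : Z i x -> Z i.+1 x.
  by move=> Zx y; rewrite /comm -!gmulA; apply: ZM; [exact: ZV|rewrite gmulA; exact: ZJ].
split=> //; first exact: sub.
- move=> x /upper_centralS Zx; apply/upper_centralS => t; apply: (cong_sym nZ).
  have := cong_mull (inv x) (cong_mulr nZ (inv x) (Zx t)).
  by rewrite !gE.
(* Conjugation is multiplication by a commutator, y^-1 x y = x [x, y], and [x, y] lies in Z_i, hence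
   in Z_(i+1). *)
- move=> x y Zx; rewrite (_ : _ ** y = x ** comm mul inv x y).
    by apply: S1M => //; exact/sub/Zx.
  by rewrite /comm !gE.
Qed.

(* Three-subgroup-lemma style estimate [gamma_{k+1}(G), Z_m(G)] <= Z_{m-k-1}(G). *)
Lemma itcomm_upper_central x k m z : (k < m)%N -> Z m z ->
  cong (Z (m - k.+1)) (itcomm mul inv x k ** z) (z ** itcomm mul inv x k).
Proof.
elim: k m z => [|k IH] [|m] z // km Zz.
  by rewrite subSS subn0 /=; move/upper_centralS: Zz; exact.
rewrite subSS /=; set c := itcomm _ _ _ _; set y := x k.+1.
have km' : (k < m)%N by [].
have nN := upper_central_normal (m - k.+1).
(* Here z lies in Z_(m+1). The elements u and a are the defects in y z = u z y and c z = a z c. By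
   induction c commutes with u modulo Z_(m-k-1), and a is central modulo Z_(m-k-1). *)
pose u := y ** z ** inv y ** inv z.
have Zu : Z m u.
  rewrite (_ : u = (y ** z) ** inv (z ** y)); last by rewrite /u !gE.
  apply: (cong_div (upper_central_normal m)).
  apply: (cong_sym (upper_central_normal m)).
  by move/upper_centralS: Zz; exact.
pose a := c ** z ** inv c ** inv z.
have Za : Z (m - k.+1).+1 a.
  rewrite (_ : a = (c ** z) ** inv (z ** c)); last by rewrite /a !gE.
  rewrite -(subSn km').
  apply: (cong_div (upper_central_normal _)).
  apply: (cong_sym (upper_central_normal _)).
  by apply: IH => //; exact: ltnW.
move/upper_centralS : Za => Za.
(* Since y c [c, y] = c y, multiplying by y c leaves c u z y on the left and y a z c [c, y] on the
   right. Moving u and a to the front gives u a z c y and a u z c y. *)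
apply: (cong_cancell (z := y ** c)).
rewrite (_ : _ ** _ ** (comm _ _ c y ** z) = c ** u ** (z ** y)); last first.
  by rewrite /comm /u !gE.
rewrite (_ : _ ** (z ** comm _ _ c y) = y ** a ** (z ** c ** comm mul inv c y));
  last by rewrite /comm /a !gE.
apply: (cong_trans nN (y := u ** c ** (z ** y))).
  by apply: cong_mulr => //; exact: IH.
apply: (cong_trans nN (y := a ** y ** (z ** c ** comm mul inv c y))); last first.
  by apply: cong_mulr => //; apply: cong_sym => //; exact: Za.
rewrite (_ : u ** c ** _ = u ** a ** (z ** c ** y)); last by rewrite /a !gE.
rewrite (_ : a ** y ** _ = a ** u ** (z ** c ** y)); last first.
  by rewrite /u /comm !gE.
by apply: cong_mulr => //; exact: Za.
Qed.

(** Each bracket costs one level of the series. If the shifted commutator is c w with w in Z_(n-m),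
    then w is central modulo Z_(n-m-1), and c commutes with the shift t of the next entry modulo
    Z_(n-m-1) by [itcomm_upper_central]; hence [c w, t y] and [c, y] agree there. *)
Lemma itcomm_cong n (x z : nat -> G) m : (forall i, Z n (z i)) -> (m <= n)%N ->
  cong (Z (n - m)) (itcomm mul inv x m)
    (itcomm mul inv (fun i => z i ** x i) m).
Proof.
move=> Zz; elim: m => [|m IH] mn.
  rewrite subn0 /= /cong; have [_ _ _ ZJ] := upper_central_normal n.
  by have := ZJ _ (x 0%N) (Zz 0%N); rewrite !gE.
move/(_ (ltnW mn)): IH => /=.
set c := itcomm _ _ x m; set c' := itcomm _ _ _ m.
set y := x _; set t := z _; set w := inv c ** c'.
rewrite -[(n - m)%N]prednK ?subn_gt0// -subnS => /upper_centralS Zw.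
have nN := upper_central_normal (n - m.+1).
have -> : c' = c ** w by rewrite /w !gE.
have Zct : cong (Z (n - m.+1)) (c ** t) (t ** c).
  exact: (itcomm_upper_central x mn (Zz m.+1)).
apply: (cong_cancell (z := t ** y ** (c ** w))).
rewrite (_ : _ ** comm _ _ (c ** w) _ = c ** (w ** (t ** y))); last first.
  by rewrite /comm !gE.
apply: (cong_trans nN (y := c ** (t ** y ** w))); last first.
  by apply: cong_mull; exact: Zw.
apply: (cong_trans nN (y := t ** y ** c ** (comm mul inv c y ** w))).
  rewrite (_ : _ ** (c ** w) ** _ = t ** y ** c ** (w ** comm mul inv c y)); last first.
    by rewrite !gE.
  by apply: cong_mull; apply: cong_sym => //; exact: Zw.
rewrite (_ : _ ** (_ ** w) = (t ** c) ** (y ** w)); last by rewrite /comm !gE.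
rewrite (_ : c ** _ = (c ** t) ** (y ** w)); last by rewrite !gE.
by apply: cong_mulr => //; exact: cong_sym.
Qed.

(** The case m = n of [itcomm_cong], where Z_0 is trivial and the congruence is an equality. *)
Lemma itcomm_central_shift n (x z : nat -> G) : (forall i, Z n (z i)) ->
  itcomm mul inv (fun i => z i ** x i) n = itcomm mul inv x n.
Proof.
move=> Zz; have := itcomm_cong x Zz (leqnn n).
rewrite subnn /cong /= => h.
by rewrite -[RHS]gmulr1 -h !gE.
Qed.

End GroupTheory.

(** * Borel sets and finite subcovers *)

Section Borel.
Variable X : topologicalType.
Implicit Types A B : set X.

Lemma open_borel A : open A -> borel A.
Proof. by move=> oA; exact: sub_sigma_algebra. Qed.

Lemma borelC A : borel A -> borel (~` A).
Proof. by move=> bA; rewrite -setTD; exact: sigma_algebraCD. Qed.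

Lemma closed_borel A : closed A -> borel A.
Proof. by move=> cA; rewrite -[A]setCK; exact: (borelC (open_borel (closed_openC cA))). Qed.

Lemma borel0 : borel (@set0 X).
Proof. exact: (open_borel open0). Qed.

Lemma borelT : borel [set: X].
Proof. exact: (open_borel openT). Qed.

Lemma borelU A B : borel A -> borel B -> borel (A `|` B).
Proof.
move=> bA bB; rewrite -bigcup2E; apply: sigma_algebra_bigcup => -[|[|i]] //=.
exact: borel0.
Qed.

Lemma borelI A B : borel A -> borel B -> borel (A `&` B).
Proof.
move=> bA bB; rewrite -[A `&` B]setCK setCI.
exact: (borelC (borelU (borelC bA) (borelC bB))).
Qed.

Lemma borelD A B : borel A -> borel B -> borel (A `\` B).
Proof. by move=> bA bB; rewrite setDE; exact: (borelI bA (borelC bB)). Qed.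

End Borel.

Lemma compact_finite_cover (X : topologicalType) (K : set X) (W : X -> set X) :
  compact K -> (forall x, K x -> nbhs x (W x)) ->
  exists s : seq X, forall y, K y -> exists2 b, b \in s & W b y.
Proof.
move=> /compact_near_coveringP cK nW.
(* [F] is the filter of properties that hold for all sufficiently large finite lists; near-covering
   along it turns pointwise membership in some [W b] into a single list for all of [K]. *)
pose F : set_system (seq X) :=
  [set P | exists s0 : seq X, forall s, {subset s0 <= s} -> P s].
have FF : Filter F.
  split=> [|P Q [s1 P1] [s2 Q2]|P Q PQ [s1 P1]]; first by exists [::].
    exists (s1 ++ s2) => s s12; split; [apply: P1|apply: Q2] => x xs.
      by apply: s12; rewrite mem_cat xs.
    by apply: s12; rewrite mem_cat xs orbT.
  by exists s1 => s /P1 /PQ.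
have [s sP] : F (fun s => K `<=` (fun y => exists2 b, b \in s & W b y)).
  apply: (cK _ F (fun s y => exists2 b, b \in s & W b y) FF) => x Kx.
  exists (W x, [set s | x \in s]) => /=.
    split; first exact: nW.
    by exists [:: x] => s; apply; rewrite mem_head.
  by move=> [y s] /= [Wy xs]; exists x.
by exists s; exact: sP.
Qed.

(** * Finite additivity, regularity and step functions for one Haar measure *)

Section Haar.
Variables (R : realType) (X : topologicalType) (mul : X -> X -> X).
Variables (S : set X) (mu : set X -> R).
Hypothesis hmu : is_haar mul S mu.

Lemma haar0 : mu set0 = 0. Proof. by case: hmu. Qed.

Lemma haarT : mu setT = 1. Proof. by case: hmu => _ [_ [_ []]]. Qed.

Lemma haar_ge0 A : borel A -> 0 <= mu A.
Proof. by case: hmu => _ [+ _]; exact. Qed.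

Lemma haar_transl s A : S s -> borel A -> mu [set mul s a | a in A] = mu A.
Proof. by case: hmu => _ [_ [_ [_ [_ [+ _]]]]]; exact. Qed.

Lemma haarU A B : borel A -> borel B -> A `&` B = set0 ->
  mu (A `|` B) = mu A + mu B.
Proof.
move=> bA bB AB0; case: hmu => mu0 [_ [sadd _]].
have /sadd /(_ _) : forall i, borel (bigcup2 A B i).
  by move=> [|[|i]] //=; exact: borel0.
rewrite bigcup2E => /(_ _) cvgmu.
apply: (cvg_unique (@Rhausdorff R) (cvgmu _)).
  by rewrite -trivIset_bigcup2.
(* All sets from index 2 on are empty, so the partial sums are eventually constant. *)
apply: cvg_near_cst; exists 2%N => // -[|[|N]] // _.
by rewrite !big_ord_recl /= big1 ?addr0// => i _; rewrite /bigcup2.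
Qed.

Lemma haarID A B : borel A -> borel B -> mu A = mu (A `&` B) + mu (A `\` B).
Proof.
move=> bA bB; rewrite -haarU; first by rewrite setUIDK.
- exact: borelI.
- exact: borelD.
- by rewrite setDE setIACA setICr setI0.
Qed.

Lemma le_haar A B : borel A -> borel B -> A `<=` B -> mu A <= mu B.
Proof.
move=> bA bB AB; rewrite (haarID bB bA) (setIidr AB) lerDl.
by apply: haar_ge0; exact: borelD.
Qed.

Lemma haarC A : borel A -> mu (~` A) = 1 - mu A.
Proof.
move=> bA; rewrite -haarT (haarID (@borelT X) bA) setTI setTD.
by rewrite addrAC subrr add0r.
Qed.

Lemma haarIS A : borel S -> borel A -> mu (A `&` S) = mu A.
Proof.
move=> bS bA; rewrite [RHS](haarID bA bS).
suff -> : mu (A `\` S) = 0 by rewrite addr0.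
apply/eqP; rewrite eq_le haar_ge0 ?andbT; last exact: borelD.
have <- : mu (~` S) = 0.
  by rewrite haarC//; case: hmu => _ [_ [_ [_ [-> _]]]]; rewrite subrr.
by apply: le_haar; [exact: borelD|exact: borelC|move=> x []].
Qed.

Lemma haar_outer A r : hausdorff_space X -> borel A ->
  (forall U, open U -> A `<=` U -> r <= mu U) -> r <= mu A.
Proof.
move=> hX bA rU; apply/ler_addgt0Pr => e e0.
case: hmu => _ [_ [_ [_ [_ [_ /(_ A e bA e0)]]]]] [K [U [cK oU KA AU UK]]].
apply: (le_trans (rU U oU AU)); rewrite -lerBlDl; apply: le_trans UK.
by rewrite lerB// le_haar//; exact: (closed_borel (compact_closed hX cK)).
Qed.

Lemma haar_inner A r : borel A ->
  (forall K, compact K -> K `<=` A -> mu K <= r) -> mu A <= r.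
Proof.
move=> bA rK; apply/ler_addgt0Pr => e e0.
case: hmu => _ [_ [_ [_ [_ [_ /(_ A e bA e0)]]]]] [K [U [cK oU KA AU UK]]].
apply: (le_trans (le_haar bA (open_borel oU) AU)).
by rewrite -lerBlDl; apply: le_trans UK; rewrite lerB// rK.
Qed.

(** Monotonicity of the integral of a step function over [D], stated without integrals. Induction
    splits [D] along [E k]: the bound is [C - c k] on the part inside and [C] on the part
    outside. *)
Lemma haar_step_le k (c : nat -> R) (E : nat -> set X) (D : set X) (C : R) :
  (forall i, borel (E i)) -> borel D ->
  (forall y, D y -> \sum_(i < k) c i * \1_(E i) y <= C) ->
  \sum_(i < k) c i * mu (E i `&` D) <= C * mu D.
Proof.
move=> bE; elim: k D C => [|k IH] D C bD cC.
  (* Nonnegativity of [C] comes from the empty sum at a point of [D], if there is one. *)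
  rewrite big_ord0; have [->|/set0P[y Dy]] := eqVneq D set0.
    by rewrite haar0 mulr0.
  by rewrite mulr_ge0 ?haar_ge0//; have := cC _ Dy; rewrite big_ord0.
have bDI : borel (D `&` E k) by exact: borelI.
have bDD : borel (D `\` E k) by exact: borelD.
have h1 : \sum_(i < k) c i * mu (E i `&` (D `&` E k)) <= (C - c k) * mu (D `&` E k).
  apply: IH => // y [Dy Ey]; rewrite lerBrDr.
  have := cC _ Dy; rewrite big_ord_recr /=.
  by rewrite [in X in _ + _ * X <= _]indicE mem_set// mulr1.
have h2 : \sum_(i < k) c i * mu (E i `&` (D `\` E k)) <= C * mu (D `\` E k).
  apply: IH => // y [Dy Ey].
  have := cC _ Dy; rewrite big_ord_recr /=.
  by rewrite [in X in _ + _ * X <= _]indicE memNset// mulr0 addr0.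
have -> : \sum_(i < k.+1) c i * mu (E i `&` D) =
    \sum_(i < k) c i * mu (E i `&` (D `&` E k)) +
    \sum_(i < k) c i * mu (E i `&` (D `\` E k)) + c k * mu (D `&` E k).
  rewrite big_ord_recr /= -big_split /= setIC; congr (_ + _).
  apply: eq_bigr => i _; rewrite -mulrDr (@haarID (E i `&` D) (E k))//.
    by rewrite setIA setIDA.
  exact: borelI.
rewrite (haarID bD (bE k)) mulrDr.
have := lerD h1 h2; rewrite mulrBl; lra.
Qed.

End Haar.

(** * Comparison of Haar measures of nested closed subgroups of a compact group *)

Section CompactGroup.
Variables (X : topologicalType) (mul : X -> X -> X) (inv : X -> X) (one : X).
Hypothesis cX : is_compact_group mul inv one.

Local Notation "x ** y" := (mul x y) (at level 40, left associativity).

Let gX : is_group mul inv one. Proof. by case: cX. Qed.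
Let hX : hausdorff_space X. Proof. by case: cX. Qed.

Lemma cvg_gmul (T : Type) (F : set_system T) (f g : T -> X) (a b : X) :
  Filter F -> f @ F --> a -> g @ F --> b -> (fun t => f t ** g t) @ F --> a ** b.
Proof.
move=> FF fa gb; case: cX => _ cmul _ _ _.
apply: (cvg_comp2 (h := mul) fa gb).
exact: (cmul (a, b)).
Qed.

Lemma cvg_ginv (T : Type) (F : set_system T) (f : T -> X) (a : X) :
  Filter F -> f @ F --> a -> (fun t => inv (f t)) @ F --> inv a.
Proof.
move=> FF fa; case: cX => _ _ cinv _ _.
by apply: (cvg_comp _ _ fa); exact: cinv.
Qed.

Lemma continuous_gmull a : continuous (mul a).
Proof. by move=> x; apply: cvg_gmul; [exact: cvg_cst|exact: cvg_id]. Qed.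

Lemma closed_compact (A : set X) : closed A -> compact A.
Proof. by move=> cA; case: cX => _ _ _ _ cT; exact: (subclosed_compact cA cT). Qed.

(** As a preimage, a translate inherits openness or closedness by continuity. *)
Lemma gtranslE b (A : set X) : [set b ** a | a in A] = [set y | A (inv b ** y)].
Proof.
apply/seteqP; split=> [_ [a Aa <-]|y /= Ay]; first by rewrite /= (gmulK gX).
by exists (inv b ** y) => //; rewrite (gmulVK gX).
Qed.

Lemma closed_gtransl b (A : set X) : closed A -> closed [set b ** a | a in A].
Proof.
move=> cA; rewrite gtranslE; apply: (preimage_closed _ cA) => x _.
exact: continuous_gmull.
Qed.

(** Tube lemma: multiplication is continuous at each (1, a), and compactness of [A] makes the
    neighbourhood of 1 uniform in a. *)
Lemma tube_gmul (A U : set X) : compact A -> open U -> A `<=` U ->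
  nbhs one [set v | forall a, A a -> U (v ** a)].
Proof.
move=> /compact_near_coveringP cA oU AU.
apply: (cA _ (nbhs one) (fun v a => U (v ** a)) _) => a Aa.
have : (fun p : X * X => p.2 ** p.1) @ (nbhs a, nbhs one) --> one ** a.
  by apply: cvg_gmul; [exact: cvg_snd|exact: cvg_fst].
by apply; apply: open_nbhs_nbhs; split=> //; rewrite (gmul1 gX); exact: AU.
Qed.

Section Compare.
Variables (R : realType) (S S' : set X) (nu mu : set X -> R).
Hypotheses (hnu : is_haar mul S nu) (hmu : is_haar mul S' mu).
Hypotheses (cS : closed S) (SS' : S `<=` S').

(* Fubini for the function [(x, y) |-> 1_A (x^-1 y)], with the integral in [x]
   replaced by a finite Riemann sum that is uniform in [y]. *)
Lemma haar_le_inv_open (A U : set X) : closed A -> open U -> A `<=` U ->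
  (forall b, exists2 s, S s & [set b ** a | a in A] = [set s ** a | a in A]) ->
  nu A <= mu [set x | U (inv x)].
Proof.
move=> cA oU AU SA.
pose W b := interior [set x | forall a, A a -> U (inv x ** b ** a)].
have nW b : [set: X] b -> nbhs b (W b).
  move=> _; apply: nbhs_interior.
  have : (fun x => inv x ** b) @ b --> inv b ** b.
    by apply: cvg_gmul; [apply: cvg_ginv; exact: cvg_id|exact: cvg_cst].
  move=> /(_ [set v | forall a, A a -> U (v ** a)]); apply.
  rewrite (gmulV gX); exact: tube_gmul (closed_compact cA) oU AU.
have [s sP] := compact_finite_cover (closed_compact closedT) nW.
(* The default [one] is harmless: only indices below [size s] enter the final sums. The sets [B k]
   make the cover disjoint. *)
pose b := nth one s.
pose D k := \bigcup_(j < k) W (b j).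
have DS k : D k.+1 = D k `|` W (b k) by rewrite /D !bigcup_mkord big_ord_recr.
have bW k : borel (W (b k)) by apply: open_borel; exact: open_interior.
have bD k : borel (D k).
  elim: k => [|k IH]; first by rewrite /D bigcup_mkord big_ord0; exact: borel0.
  by rewrite DS; exact: borelU.
pose B k := W (b k) `\` D k.
have bB k : borel (B k) by exact: borelD.
have sumB k E : borel E -> \sum_(i < k) mu (B i `&` E) = mu (D k `&` E).
  move=> bE; elim: k => [|k IH].
    by rewrite big_ord0 /D bigcup_mkord big_ord0 set0I (haar0 hmu).
  rewrite big_ord_recr /= IH -(haarU hmu).
  - rewrite DS /B -setIUl; congr (mu (_ `&` _)).
    by rewrite setDE setUIr setUv setIT.
  - exact: borelI.
  - exact: borelI.
  - by apply/seteqP; split=> // y [[Dy _] [[_ /(_ Dy)]]].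
have DT : D (size s) = setT.
  apply/seteqP; split=> // y _; have [c cs Wy] := sP y I.
  exists (index c s); first by rewrite /= index_mem.
  by rewrite /b nth_index.
have bUi y : borel [set y ** x | x in [set x | U (inv x)]].
  apply: open_borel; rewrite gtranslE /=.
  apply: (open_comp (f := fun x => inv (inv y ** x)) _ oU) => x _.
  apply: cvg_ginv; exact: continuous_gmull.
pose E i := [set b i ** a | a in A].
have bE i : borel (E i) by apply: closed_borel; exact: closed_gtransl.
have bS : borel S by exact: closed_borel.
have nuE i : nu (E i `&` S) = nu A.
  rewrite (haarIS hnu)// /E; have [t St ->] := SA (b i).
  by rewrite (haar_transl hnu)//; exact: closed_borel.
(* The weights mu(B_i) add up to 1, and the integration runs over [S] because mu(y U^-1) = mu(U^-1)
   is available for y in [S]. *)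
have := haar_step_le hnu (k := size s) (c := fun i => mu (B i)) (E := E)
  (C := mu [set x | U (inv x)]) bE bS.
rewrite (_ : nu S = 1); last by rewrite -(setTI S) (haarIS hnu) ?(haarT hnu)//; exact: borelT.
under eq_bigr do rewrite nuE.
rewrite -mulr_suml mulr1 (_ : \sum_(i < size s) mu (B i) = 1); last first.
  under eq_bigr do rewrite -[B _]setIT.
  by rewrite sumB ?DT ?setIT ?(haarT hmu)//; exact: borelT.
rewrite mul1r; apply => y Sy.
rewrite -(haar_transl hmu (SS' Sy)); last first.
  by have := bUi one; rewrite gtranslE; under eq_set do rewrite (ginv1 gX) (gmul1 gX).
set V := (X in _ <= mu X).
have -> : mu V = \sum_(i < size s) mu (B i `&` V).
  by rewrite sumB ?DT ?setTI//; exact: bUi.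
apply: ler_sum => i _; rewrite indicE.
case: (boolP (y \in _)) => [/set_mem [a Aa ya]|_]; last first.
  rewrite mulr0; apply: (haar_ge0 hmu); apply: borelI => //; exact: bUi.
(* If y = b_i a with a in [A], every x in B_i satisfies x^-1 y = x^-1 b_i a in [U], so x lies in y
   U^-1. *)
rewrite mulr1 (_ : B i `&` V = B i)//.
apply: setIidl => x [/interior_subset /= Wx _].
rewrite /V gtranslE /= (ginvM gX) (ginvK gX) -ya (gmulA gX); exact: Wx.
Qed.

End Compare.

Section Saturated.
Variables (R : realType) (S S' Z : set X) (nu mu : set X -> R).
Hypotheses (hnu : is_haar mul S nu) (hmu : is_haar mul S' mu).
Hypotheses (cS : closed S) (cS' : closed S') (SS' : S `<=` S').
Hypotheses (cZ : closed Z) (nZ : normal_subgroup mul inv one Z).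
Hypothesis SZ : forall g, exists2 s, S s & exists2 z, Z z & g = s ** z.

(** For normal [Z] these are the preimages of subsets of X / Z. *)
Definition saturated (A : set X) := forall z a, Z z -> A a -> A (z ** a).

Lemma saturated_inv (A : set X) : saturated A -> saturated [set x | A (inv x)].
Proof.
move=> sA z a Zz /= Aa; case: nZ => _ _ ZV ZJ; rewrite (ginvM gX).
rewrite -[inv a ** inv z](gmulr1 gX) -(gmulV gX (inv a)) (gmulA gX).
apply: (sA) => //; have := ZJ _ a (ZV _ Zz).
by rewrite (ginvK gX).
Qed.

(** Writing b = s z gives b A = s (z A) = s A. *)
Lemma saturated_transl (A : set X) b : saturated A ->
  exists2 s, S s & [set b ** a | a in A] = [set s ** a | a in A].
Proof.
move=> sA; have [s Ss [z Zz ->]] := SZ b; exists s => //.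
rewrite !gtranslE; apply/seteqP; split=> y /=; rewrite (ginvM gX) => Ay.
  rewrite -[inv s ** y](gmulVK gX z) (gmulA gX (inv z)); exact: sA.
by rewrite -(gmulA gX); apply: sA => //; case: nZ => _ _ ZV _; exact: ZV.
Qed.

Lemma closed_inv (A : set X) : closed A -> closed [set x | A (inv x)].
Proof.
move=> cA; apply: (preimage_closed (f := inv) _ cA) => x _.
by case: cX => _ _ + _ _; exact.
Qed.

Lemma haar_closed_le (A : set X) : closed A -> saturated A -> nu A <= mu A.
Proof.
(* The first measure is left general: it is [nu] for nu(A) <= mu(A^-1), then [mu] itself for
   mu(A^-1) <= mu(A). *)
have le_inv S1 nu1 (B : set X) : is_haar mul S1 nu1 -> closed S1 -> S1 `<=` S' ->
    S `<=` S1 -> closed B -> saturated B -> nu1 B <= mu [set x | B (inv x)].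
  move=> hnu1 cS1 S1S' SS1 cB sB.
  have cB' := closed_inv cB.
  apply: (haar_outer hmu hX (closed_borel cB')) => U oU BU.
  have -> : U = [set x | [set x | U (inv x)] (inv x)].
    by apply/seteqP; split=> x /=; rewrite (ginvK gX).
  apply: (haar_le_inv_open hnu1 hmu) => //.
  - apply: (open_comp (f := inv) _ oU) => x _.
    by case: cX => _ _ + _ _; exact.
  - by move=> x Bx /=; apply: BU; rewrite /= (ginvK gX).
  - by move=> b; have [s Ss ->] := saturated_transl b sB; exists s => //; exact: SS1.
move=> cA sA; apply: (le_trans (le_inv _ _ _ hnu cS SS' _ cA sA)) => //.
rewrite [X in _ <= mu X](_ : A = [set x | [set x | A (inv x)] (inv x)]).
  apply: (le_inv _ _ _ hmu cS') => //; first exact: closed_inv.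
  exact: saturated_inv.
by apply/seteqP; split=> x /=; rewrite (ginvK gX).
Qed.

Lemma haar_saturated_eq (A : set X) : closed A -> saturated A -> nu A = mu A.
Proof.
move=> cA sA; apply/eqP; rewrite eq_le haar_closed_le//=.
have bA := closed_borel cA.
rewrite -lerN2 -(lerD2l 1) -(haarC hnu bA) -(haarC hmu bA).
apply: (haar_inner hnu (borelC bA)) => K cK KA.
(* [K] need not be saturated. Z K is, it is compact as the image of Z x K, and it still misses [A]
   because [A] is saturated. *)
pose ZK := [set p.1 ** p.2 | p in Z `*` K].
have [Z1 ZM ZV _] := nZ.
have cZK : closed ZK.
  apply: (compact_closed hX); apply: continuous_compact.
    by apply: continuous_subspaceT; case: cX => _ + _ _ _; exact.
  by apply: compact_setX => //; exact: closed_compact.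
have sZK : saturated ZK.
  move=> z _ Zz [[w k] [/= Zw Kk] <-]; exists (z ** w, k) => /=.
    by split=> //; exact: ZM.
  by rewrite (gmulA gX).
apply: (@le_trans _ _ (nu ZK)).
  apply: (le_haar hnu); [|exact: closed_borel|].
    exact: (closed_borel (compact_closed hX cK)).
  by move=> k Kk; exists (one, k) => //=; rewrite (gmul1 gX).
apply: (le_trans (haar_closed_le cZK sZK)).
apply: (le_haar hmu (closed_borel cZK) (borelC bA)).
move=> _ [[z k] [/= Zz Kk] <-] Azk; apply: (KA _ Kk).
by rewrite -(gmulK gX z k); apply: sA => //; exact: ZV.
Qed.

End Saturated.
End CompactGroup.

(** * The power G^k as a compact group *)

Section Power.
Variables (G : topologicalType) (k : nat).

Lemma pow_proj_continuous (i : 'I_k) : continuous (fun x : pow_space G k => x i).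
Proof. exact: (@proj_continuous _ (fun=> G) i). Qed.

Lemma pow_cvg (T : Type) (F : set_system T) (f : T -> pow_space G k)
    (a : pow_space G k) : Filter F ->
  (forall i, (fun t => f t i) @ F --> a i) -> f @ F --> a.
Proof.
move=> FF fa; apply/cvg_sup => i U [V] [[W oW <-] Wa WU].
apply: (filterS WU); apply: (fa i W); exact: open_nbhs_nbhs.
Qed.

(** [P] selects the constrained coordinates, so that H^n x G is covered as well. *)
Lemma closed_pow (P : 'I_k -> Prop) (N : set G) : closed N ->
  closed [set x : pow_space G k | forall i, P i -> N (x i)].
Proof.
move=> cN; rewrite (_ : mkset _ =
    \bigcap_(i in [set i | P i]) ((fun x : pow_space G k => x i) @^-1` N)) //.
apply: closed_bigI => i _; apply: (preimage_closed _ cN) => x _.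
exact: pow_proj_continuous.
Qed.

Lemma closed_powT (N : set G) : closed N ->
  closed [set x : pow_space G k | forall i, N (x i)].
Proof.
move=> cN; rewrite (_ : mkset _ = [set x | forall i, True -> N (x i)]).
  exact: (@closed_pow (fun=> True)).
by apply/seteqP; split=> x /= Nx i //; exact: Nx.
Qed.

Variables (mul : G -> G -> G) (inv : G -> G) (one : G).
Hypothesis cG : is_compact_group mul inv one.

Definition pinv (x : pow_space G k) : pow_space G k := fun i => inv (x i).
Definition pone : pow_space G k := fun=> one.

Lemma pow_compact_group : is_compact_group (@pmul G k mul) pinv pone.
Proof.
have [gG _ _ hG cT] := cG; split.
- split=> *; apply/funext => i.
  + exact: (gmulA gG).
  + exact: (gmul1 gG).
  + exact: (gmulr1 gG).
  + exact: (gmulV gG).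
  + exact: (gmulrV gG).
- move=> p; apply: pow_cvg => i; apply: (cvg_gmul cG).
    exact: (cvg_comp _ _ (@cvg_fst _ _ (nbhs p.1) (nbhs p.2) _) (@pow_proj_continuous i p.1)).
  exact: (cvg_comp _ _ (@cvg_snd _ _ (nbhs p.1) (nbhs p.2) _) (@pow_proj_continuous i p.2)).
- move=> x; apply: (pow_cvg (nbhs_filter x)) => i.
  exact: (cvg_ginv cG (nbhs_filter x) (@pow_proj_continuous i x)).
- exact: (@hausdorff_product _ (fun=> G)).
- rewrite (_ : [set: _] = [set x | forall i, [set: G] (x i)]).
    exact: (@tychonoff _ (fun=> G) (fun=> setT)).
  by apply/seteqP; split.
Qed.

Lemma pow_normal_subgroup (N : set G) : normal_subgroup mul inv one N ->
  normal_subgroup (@pmul G k mul) pinv pone [set x | forall i, N (x i)].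
Proof.
case=> N1 NM NV NJ; split=> [i|x y Nx Ny i|x Nx i|x y Nx i] //=.
- exact: NM.
- exact: NV.
- exact: NJ.
Qed.

End Power.

(** * The set of tuples with trivial commutator: closed and saturated *)

Section NilpotencyDegree.
Variables (G : topologicalType) (mul : G -> G -> G) (inv : G -> G) (one : G).
Hypothesis cG : is_compact_group mul inv one.

Let gG : is_group mul inv one. Proof. by case: cG. Qed.

(** Z_(i+1) is the intersection over y of the preimages of Z_i under the continuous maps x |->
    [x, y]. *)
Lemma upper_central_closed i : closed (upper_central mul inv one i).
Proof.
elim: i => [|i IH] /=.
  by apply: accessible_closed_set1; apply: hausdorff_accessible; case: cG.
rewrite (_ : mkset _ = \bigcap_(y in setT)
    ((fun x => comm mul inv x y) @^-1` upper_central mul inv one i)); last first.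
  by apply/seteqP; split=> x /= h y; [move=> _; exact: h|exact: h].
apply: closed_bigI => y _; apply: (preimage_closed _ IH) => x _.
by do ![apply: (cvg_gmul cG)|apply: (cvg_ginv cG)|exact: cvg_cst|exact: cvg_id].
Qed.

Lemma comm_trivial_closed n : closed (comm_trivial mul inv one n).
Proof.
have itcomm_cvg m : continuous (fun x : pow_space G n.+1 =>
    itcomm mul inv (fun i => x (inord i)) m).
  move=> x; have Fx := nbhs_filter x.
  have px i : (fun y : pow_space G n.+1 => y i) @ x --> x i.
    exact: pow_proj_continuous.
  elim: m => [|m IH] /=; first exact: px.
  by do ![apply: (cvg_gmul cG)|apply: (cvg_ginv cG)|exact: IH|exact: px].
(* Z_0 = {1}, so this is the closedness of the point 1. *)
have c1 := @upper_central_closed 0.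
by apply: (preimage_closed _ c1) => x _; exact: itcomm_cvg.
Qed.

Lemma comm_trivial_saturated n : saturated (@pmul G n.+1 mul)
  [set x | forall i, upper_central mul inv one n (x i)]
  (comm_trivial mul inv one n).
Proof.
move=> z x Zz; rewrite /comm_trivial /= => <-.
exact: (itcomm_central_shift gG (fun i => x (inord i)) (fun i => Zz (inord i))).
Qed.

End NilpotencyDegree.

Theorem theorem1p2 (R : realType) (G : topologicalType)
    (mul : G -> G -> G) (inv : G -> G) (one : G) (H : set G) (n : nat)
    (muH muHG muG : set (pow_space G n.+1) -> R) :
  (1 <= n)%N ->
  is_compact_group mul inv one ->
  is_closed_subgroup mul inv one H ->
  (forall g, exists2 h, H h & exists2 z, upper_central mul inv one n z & g = mul h z) ->
  is_haar (pmul mul) [set x | forall i, H (x i)] muH ->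
  is_haar (pmul mul) [set x | forall i, i != ord_max -> H (x i)] muHG ->
  is_haar (pmul mul) setT muG ->
  muH (comm_trivial mul inv one n) = muHG (comm_trivial mul inv one n) /\
  muHG (comm_trivial mul inv one n) = muG (comm_trivial mul inv one n).
Proof.
move=> _ cG [cH _ _ _] HZ hmuH hmuHG hmuG.
have [gG _ _ _ _] := cG.
have cX := pow_compact_group n.+1 cG.
have nZ := pow_normal_subgroup n.+1 (upper_central_normal gG n).
pose Zn := [set x : pow_space G n.+1 | forall i, upper_central mul inv one n (x i)].
have cZ : closed Zn.
  exact: (closed_powT (@upper_central_closed _ _ _ _ cG n)).
have cS1 : closed [set x : pow_space G n.+1 | forall i, H (x i)].
  exact: closed_powT.
have cS2 : closed [set x : pow_space G n.+1 | forall i, i != ord_max -> H (x i)].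
  exact: (@closed_pow _ _ (fun i => i != ord_max) _ cH).
have SZ (g : pow_space G n.+1) : exists2 s, [set x | forall i, H (x i)] s &
    exists2 z, Zn z & g = pmul mul s z.
  have /choice[s sP] : forall i, exists h, H h /\
      exists2 z, upper_central mul inv one n z & g i = mul h z.
    by move=> i; have [h Hh hz] := HZ (g i); exists h.
  (* The H-parts are chosen coordinatewise, and the central parts are then forced to be s_i^-1
     g_i. *)
  exists s; first by move=> i; case: (sP i).
  exists (fun i => mul (inv (s i)) (g i)).
    by move=> i; have [_ [z Zz ->]] := sP i; rewrite (gmulK gG).
  by apply/funext => i; rewrite /pmul (gmulVK gG).
have cA := @comm_trivial_closed _ _ _ _ cG n.
have sA := @comm_trivial_saturated _ _ _ _ cG n.
split.
  apply: (haar_saturated_eq cX hmuH hmuHG cS1 cS2 _ cZ nZ SZ cA sA).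
  by move=> x Hx i _; exact: Hx.
apply: (haar_saturated_eq cX hmuHG hmuG cS2 closedT _ cZ nZ _ cA sA) => //.
(* The factorization through H^(n+1) also serves the larger subgroup H^n x G. *)
move=> g; have [s Ss sz] := SZ g; exists s => // i _; exact: Ss.
Qed.
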